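(* For every theory $\Gamma$ and every sentence $\varphi$ of $\mathcal{L}_3$: $\Gamma\models\varphi$ if and only if $\Gamma\vdash\varphi$.
   Context: Syntax of $\mathcal{L}_3$. Fix a set $P$ of nouns and a set $R$ of verbs. Terms: every noun $p\in P$ is a term; if $r\in R$ and $x$ is a term then $(r\ \mathsf{all}\ x)$ and $(r\ \mathsf{some}\ x)$ are terms. Sentences: $(\mathsf{all}\ x\ y)$ for terms $x,y$. A theory is a set of sentences. Semantics. A model $\mathcal{M}$ is a set $M$ (possibly empty) with $[\![p]\!]\subseteq M$ for $p\in P$ and $[\![r]\!]\subseteq M\times M$ for $r\in R$; $[\![r\ \mathsf{all}\ x]\!]=\{m\in M: m\,[\![r]\!]\,n\text{ for all }n\in[\![x]\!]\}$; $[\![r\ \mathsf{some}\ x]\!]=\{m\in M: m\,[\![r]\!]\,n\text{ for some }n\in[\![x]\!]\}$. $\mathcal{M}\models(\mathsf{all}\ x\ y)$ iff $[\![x]\!]\subseteq[\![y]\!]$. $\Gamma\models\varphi$ means every model of $\Gamma$ satisfies $\varphi$. Provability $\Gamma\vdash\varphi$ is defined by finite derivations using the following rules (for all terms $x,y,z$, verbs $r,s$ (possibly different), sentences $\varphi$), with non-withdrawn assumptions in $\Gamma$: infer $(\mathsf{all}\ x\ x)$ from no premises; from $(\mathsf{all}\ x\ y)$, $(\mathsf{all}\ y\ z)$ infer $(\mathsf{all}\ x\ z)$; from $(\mathsf{all}\ x\ y)$ infer $(\mathsf{all}\ (r\ \mathsf{all}\ y)\ (r\ \mathsf{all}\ x))$;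 from $(\mathsf{all}\ x\ y)$ infer $(\mathsf{all}\ (r\ \mathsf{some}\ x)\ (r\ \mathsf{some}\ y))$; from $(\mathsf{all}\ (r\ \mathsf{all}\ y)\ (r\ \mathsf{some}\ y))$ and $(\mathsf{all}\ y\ (r\ \mathsf{some}\ x))$ infer $(\mathsf{all}\ (s\ \mathsf{all}\ x)\ (s\ \mathsf{some}\ x))$; first cases rule: given a derivation of $\varphi$ from $\Gamma\cup\{(\mathsf{all}\ (r\ \mathsf{all}\ x)\ (r\ \mathsf{some}\ x))\}$ and a derivation of $\varphi$ from $\Gamma\cup\{(\mathsf{all}\ y\ (s\ \mathsf{all}\ x))\}$, conclude $\varphi$ from $\Gamma$; second cases rule: given a derivation of $\varphi$ from $\Gamma\cup\{(\mathsf{all}\ (r\ \mathsf{all}\ x)\ (r\ \mathsf{some}\ x))\}$ and a derivation of $\varphi$ from $\Gamma\cup\{(\mathsf{all}\ x\ y)\}$, conclude $\varphi$ from $\Gamma$. (In the cases rules the displayed extra assumptions are withdrawn, zero or more occurrences.) *)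

(* Defs.v *)
From mathcomp Require Import classical_sets.

Local Open Scope classical_set_scope.

(** [P] is the set of nouns and [R] the set of verbs; no finiteness,
    countability, decidability or nonemptiness is assumed of either. *)

Inductive term (P R : Type) : Type :=
  | Noun (p : P)
  | RAll (r : R) (x : term P R)
  | RSome (r : R) (x : term P R).

Arguments Noun {P R} p.
Arguments RAll {P R} r x.
Arguments RSome {P R} r x.

Inductive sentence (P R : Type) : Type :=
  | All (x y : term P R).

Arguments All {P R} x y.

Definition theory (P R : Type) := set (sentence P R).

(** The carrier is an arbitrary type, so empty models are included. *)
Record model (P R : Type) : Type := Model {
  carrier : Type;
  noun_interp : P -> set carrier;
  verb_interp : R -> set (carrier * carrier)%type
}.

Arguments carrier {P R} m.
Arguments noun_interp {P R} m p.
Arguments verb_interp {P R} m r.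

Fixpoint interp {P R : Type} (M : model P R) (t : term P R) :
    set (carrier M) :=
  match t with
  | Noun p => noun_interp M p
  | RAll r x =>
      [set m | forall n, interp M x n -> verb_interp M r (m, n)]
  | RSome r x =>
      [set m | exists n, interp M x n /\ verb_interp M r (m, n)]
  end.

Definition satisfies {P R : Type} (M : model P R) (phi : sentence P R) :
    Prop :=
  let: All x y := phi in interp M x `<=` interp M y.

Definition satisfies_theory {P R : Type} (M : model P R)
    (Gamma : theory P R) : Prop :=
  forall psi, Gamma psi -> satisfies M psi.

Definition entails {P R : Type} (Gamma : theory P R) (phi : sentence P R) :
    Prop :=
  forall M : model P R, satisfies_theory M Gamma -> satisfies M phi.

(** [derives Gamma phi]: there is a finite derivation of [phi] all of whose
    non-withdrawn assumptions are in [Gamma].  An assumption withdrawn by a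
    cases rule is one that the subderivation may use zero or more times, hence
    the extended theories in the premises of [d_cases1] and [d_cases2]. *)
Inductive derives {P R : Type} :
    theory P R -> sentence P R -> Prop :=
  | d_assumption (Gamma : theory P R) (phi : sentence P R) :
      Gamma phi -> derives Gamma phi
  | d_axiom (Gamma : theory P R) (x : term P R) :
      derives Gamma (All x x)
  | d_barbara (Gamma : theory P R) (x y z : term P R) :
      derives Gamma (All x y) ->
      derives Gamma (All y z) ->
      derives Gamma (All x z)
  | d_anti (Gamma : theory P R) (r : R) (x y : term P R) :
      derives Gamma (All x y) ->
      derives Gamma (All (RAll r y) (RAll r x))
  | d_mono (Gamma : theory P R) (r : R) (x y : term P R) :
      derives Gamma (All x y) ->
      derives Gamma (All (RSome r x) (RSome r y))
  | d_nonempty (Gamma : theory P R) (r s : R) (x y : term P R) :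
      derives Gamma (All (RAll r y) (RSome r y)) ->
      derives Gamma (All y (RSome r x)) ->
      derives Gamma (All (RAll s x) (RSome s x))
  | d_cases1 (Gamma : theory P R) (r s : R) (x y : term P R)
      (phi : sentence P R) :
      derives (Gamma `|` [set All (RAll r x) (RSome r x)]) phi ->
      derives (Gamma `|` [set All y (RAll s x)]) phi ->
      derives Gamma phi
  | d_cases2 (Gamma : theory P R) (r : R) (x y : term P R)
      (phi : sentence P R) :
      derives (Gamma `|` [set All (RAll r x) (RSome r x)]) phi ->
      derives (Gamma `|` [set All x y]) phi ->
      derives Gamma phi.

(* Main.v *)
Require Import Defs.
From mathcomp Require Import ssreflect ssrfun ssrbool boolp classical_sets.

Set Implicit Arguments.
Unset Strict Implicit.
Unset Printing Implicit Defensive.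

Local Open Scope classical_set_scope.

(** Soundness is an induction on derivations; the last three rules split on
    whether the denotation of a term is empty.

    For completeness, let [Gamma] not derive [phi].  Derivations use finitely
    many assumptions, so Zorn's lemma yields a theory [D] containing [Gamma]
    that is maximal among those not deriving [phi] ([maximal_extension]).  Write
    [x <= y] for derivability of [All x y] from [D], and call [x] inhabited
    ([provably_inhabited]) when [r all x <= r some x] for every verb [r].  By
    maximality, the two cases rules become a dichotomy: either [x] is inhabited,
    or [x <= y] and [y <= s all x] for all [y] and [s] ([vacuous_below],
    [vacuous_RAll]).  So a term that is not inhabited may be interpreted by the
    empty set.

    The canonical model has two points for each inhabited term [x], each meant
    as a generic element of [x].  A point over [y] is [r]-related to one over
    [z] when [y <= r all z]; it is also [r]-related to the second point over [z]
    when [y <= r some z].  The second point thus provides witnesses for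
    [r some z], and the first one provides counterexamples to [r all z].
    The truth lemma [interp_canonical] says that a point over [y] belongs to the
    denotation of [x] exactly when [y <= x].  Hence the model satisfies [Gamma].
    If [phi] is [All x y], then [x] is inhabited, since otherwise [x <= y], and
    a point over [x] refutes [phi]. *)

Section Logic.
Variables P R : Type.
Implicit Types (Gamma Delta G D X : theory P R) (phi psi : sentence P R).
Implicit Types (x y z : term P R) (r s : R).

Lemma RAll_sub_RSome (M : model P R) r x :
  interp M x !=set0 -> interp M (RAll r x) `<=` interp M (RSome r x).
Proof. by move=> [n xn] m allm; exists n; split=> //; apply: allm. Qed.

Lemma soundness Gamma phi : derives Gamma phi -> entails Gamma phi.
Proof.
have extend (M : model P R) G psi : satisfies_theory M G -> satisfies M psi ->
    satisfies_theory M (G `|` [set psi]).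
  by move=> MG Mpsi chi [/MG//| ->].
elim=> {Gamma phi}.
- by move=> G phi Gphi M; apply.
- by move=> G x M _ m.
- by move=> G x y z _ xy _ yz M MG m /(xy M MG)/(yz M MG).
- by move=> G r x y _ xy M MG m allm n /(xy M MG)/allm.
- by move=> G r x y _ xy M MG m [n [/(xy M MG) yn rmn]]; exists n.
- move=> G r s x y _ ey _ yx M MG m allm.
  have [yn0|y0] := pselect (interp M y !=set0).
    apply: RAll_sub_RSome (m) allm.
    by have [n /(yx M MG)[k [xk _]]] := yn0; exists k.
  (* If [y] is empty, the first premise forces the whole model to be empty. *)
  have [|n [yn _]] := ey M MG m; last by case: y0; exists n.
  by move=> n yn; case: y0; exists n.
- move=> G r s x y phi _ ex _ yx M MG.
  have [xn0|x0] := pselect (interp M x !=set0).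
    by apply/ex/extend => //; apply: RAll_sub_RSome.
  by apply/yx/extend => // m _ n xn; case: x0; exists n.
- move=> G r x y phi _ ex _ xy M MG.
  have [xn0|x0] := pselect (interp M x !=set0).
    by apply/ex/extend => //; apply: RAll_sub_RSome.
  by apply/xy/extend => // n xn; case: x0; exists n.
Qed.

Lemma derives_weaken Gamma Delta phi :
  Gamma `<=` Delta -> derives Gamma phi -> derives Delta phi.
Proof.
move=> sub der; elim: der Delta sub => {Gamma phi}.
- by move=> G phi Gphi D sub; apply/d_assumption/sub.
- by move=> *; apply: d_axiom.
- by move=> G x y z _ xy _ yz D sub; apply: d_barbara (xy _ sub) (yz _ sub).
- by move=> G r x y _ xy D sub; apply/d_anti/xy.
- by move=> G r x y _ xy D sub; apply/d_mono/xy.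
- move=> G r s x y _ ey _ yx D sub.
  exact: d_nonempty (ey _ sub) (yx _ sub).
- move=> G r s x y phi _ ex _ yx D sub.
  by apply: (d_cases1 _ r s x y);
    [apply: ex|apply: yx]; apply: setSU.
- move=> G r x y phi _ ex _ xy D sub.
  by apply: (d_cases2 _ r x y);
    [apply: ex|apply: xy]; apply: setSU.
Qed.

(** Derivations are finite, in the form that Zorn's lemma needs.  The theory [G]
    is kept apart from the chain so that it can absorb the assumptions
    withdrawn by the cases rules. *)
Lemma derives_chain (F : set (theory P R)) Delta phi :
  F !=set0 -> total_on F subset -> derives Delta phi ->
  forall G, Delta `<=` G `|` \bigcup_(X in F) X ->
  exists2 X, F X & derives (G `|` X) phi.
Proof.
move=> [X0 FX0] chain.
have merge G1 G2 phi1 phi2 : (exists2 X, F X & derives (G1 `|` X) phi1) ->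
    (exists2 X, F X & derives (G2 `|` X) phi2) ->
    exists X, [/\ F X, derives (G1 `|` X) phi1 & derives (G2 `|` X) phi2].
  move=> [X FX d1] [Y FY d2].
  have [XY|YX] := chain _ _ FX FY.
    by exists Y; split=> //; apply: derives_weaken d1; apply: setUS.
  by exists X; split=> //; apply: derives_weaken d2; apply: setUS.
have extend D G psi : D `<=` G `|` \bigcup_(X in F) X ->
    D `|` [set psi] `<=` (G `|` [set psi]) `|` \bigcup_(X in F) X.
  by move=> sub; rewrite setUAC; apply: setSU.
elim=> {Delta phi}.
- move=> D phi Dphi G /(_ _ Dphi)[Gphi|[X FX Xphi]].
    by exists X0 => //; apply: d_assumption; left.
  by exists X => //; apply: d_assumption; right.
- by move=> D x G _; exists X0 => //; apply: d_axiom.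
- move=> D x y z _ xy _ yz G sub.
  have [X [FX d1 d2]] := merge _ _ _ _ (xy _ sub) (yz _ sub).
  by exists X => //; apply: d_barbara d1 d2.
- by move=> D r x y _ xy G /xy[X FX d]; exists X => //; apply: d_anti.
- by move=> D r x y _ xy G /xy[X FX d]; exists X => //; apply: d_mono.
- move=> D r s x y _ ey _ yx G sub.
  have [X [FX d1 d2]] := merge _ _ _ _ (ey _ sub) (yx _ sub).
  by exists X => //; apply: d_nonempty d1 d2.
- move=> D r s x y phi _ ex _ yx G sub.
  have [X [FX d1 d2]] :=
    merge _ _ _ _ (ex _ (extend _ _ _ sub)) (yx _ (extend _ _ _ sub)).
  rewrite setUAC in d1; rewrite setUAC in d2.
  by exists X => //; apply: d_cases1 d1 d2.
- move=> D r x y phi _ ex _ xy G sub.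
  have [X [FX d1 d2]] :=
    merge _ _ _ _ (ex _ (extend _ _ _ sub)) (xy _ (extend _ _ _ sub)).
  rewrite setUAC in d1; rewrite setUAC in d2.
  by exists X => //; apply: d_cases2 d1 d2.
Qed.

Lemma maximal_extension Gamma phi : ~ derives Gamma phi ->
  exists D, [/\ Gamma `<=` D, ~ derives D phi &
    forall psi, ~ D psi -> derives (D `|` [set psi]) phi].
Proof.
move=> nd.
(* Zorn's lemma includes the empty chain, whose union does not contain [Gamma];
   so the sets to be added to [Gamma] are ordered, not its extensions. *)
have [|A [ndA maxA]] :=
    @Zorn_bigcup _ [set A : theory P R | ~ derives (Gamma `|` A) phi].
  move=> F FP chain /= der.
  have [F0|Fn0] := pselect (F !=set0).
    by have [X /FP] := derives_chain F0 chain der (@subset_refl _ _).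
  apply: nd; apply: derives_weaken der => psi [//|[X FX _]].
  by case: Fn0; exists X.
exists (Gamma `|` A); split=> //.
move=> psi nDpsi; apply: contrapT => nd'.
apply: (maxA (A `|` [set psi])); last by rewrite /= setUA.
split=> [|sub]; first exact: subsetUl.
by apply: nDpsi; right; apply: sub; right.
Qed.

Section CanonicalModel.
Variables (D : theory P R) (phi : sentence P R).
Hypothesis D_consistent : ~ derives D phi.
Hypothesis D_maximal : forall psi, ~ D psi -> derives (D `|` [set psi]) phi.

(** The preorder on terms given by derivability from [D]. *)
Definition below x y := derives D (All x y).

Lemma below_trans x y z : below x y -> below y z -> below x z.
Proof. exact: d_barbara. Qed.

(** The theory [D] says that [x] is nonempty, as far as the language can
    express it. *)
Definition provably_inhabited x := forall r, below (RAll r x) (RSome r x).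

Lemma not_below_extend x y : ~ below x y -> derives (D `|` [set All x y]) phi.
Proof. by move=> nxy; apply: D_maximal => Dxy; apply/nxy/d_assumption. Qed.

Lemma vacuous_below x y : ~ provably_inhabited x -> below x y.
Proof.
move=> /existsNP[r nr]; apply: contrapT => nxy.
by apply: D_consistent;
  apply: (d_cases2 _ r x y); apply: not_below_extend.
Qed.

Lemma vacuous_RAll x y s : ~ provably_inhabited x -> below y (RAll s x).
Proof.
move=> /existsNP[r nr]; apply: contrapT => nyx.
by apply: D_consistent;
  apply: (d_cases1 _ r s x y); apply: not_below_extend.
Qed.

Lemma provably_inhabited_RSome r x y :
  provably_inhabited y -> below y (RSome r x) ->
  provably_inhabited x.
Proof. by move=> iy yx s; apply: d_nonempty (iy r) yx. Qed.

(** Points are pairs of a provably inhabited term and a boolean; [true] marks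
    the point that serves as a witness for [RSome].  If no term is provably
    inhabited, the model is empty. *)
Definition canonical : model P R := {|
  carrier := ({x : term P R | provably_inhabited x} * bool)%type;
  noun_interp := fun p => [set m | below (sval m.1) (Noun p)];
  verb_interp := fun r => [set mn |
    below (sval mn.1.1) (RAll r (sval mn.2.1)) \/
    (mn.2.2 = true /\ below (sval mn.1.1) (RSome r (sval mn.2.1)))] |}.

Lemma interp_canonical x (m : carrier canonical) :
  interp canonical x m <-> below (sval m.1) x.
Proof.
elim: x m => [p|r x IHx|r x IHx] [[y iy] a] //=.
- split=> [allm|yx [[z iz] b] /IHx /= zx]; last first.
    by left; apply: below_trans yx _; apply: d_anti.
  have [ix|/vacuous_RAll] := pselect (provably_inhabited x); last exact.
  have xx : interp canonical x (exist _ x ix, false) by apply/IHx/d_axiom.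
  by have [|[]] := allm _ xx.
- split=> [[[[z iz] b] [/IHx /= zx yz]]|yx].
    apply: (@below_trans _ (RSome r z)); last exact: d_mono.
    by case: yz => [yz|[_ //]]; apply: below_trans yz (iz r).
  have ix := provably_inhabited_RSome iy yx.
  exists (exist _ x ix, true); split; last by right.
  by apply/IHx/d_axiom.
Qed.

Lemma canonical_models : satisfies_theory canonical D.
Proof.
move=> [x y] Dxy m /interp_canonical mx; apply/interp_canonical.
exact/(below_trans mx)/d_assumption.
Qed.

Lemma canonical_refutes : ~ satisfies canonical phi.
Proof.
case Ephi: phi => [x y] sat.
have nxy : ~ below x y by rewrite /below -Ephi.
have [ix|nix] := pselect (provably_inhabited x); last first.
  exact/nxy/vacuous_below.
have xx : interp canonical x (exist _ x ix, true).
  by apply/interp_canonical/d_axiom.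
by have /interp_canonical := sat _ xx.
Qed.

End CanonicalModel.

Lemma completeness Gamma phi : entails Gamma phi -> derives Gamma phi.
Proof.
move=> ent; apply: contrapT => /maximal_extension[D [sub nd maxD]].
apply: (canonical_refutes nd maxD); apply: ent => psi /sub.
exact: (canonical_models nd maxD).
Qed.

End Logic.

Unset Implicit Arguments.

Theorem theorem3p9 (P R : Type) (Gamma : theory P R) (phi : sentence P R) :
  entails Gamma phi <-> derives Gamma phi.
Proof. by split; [apply: completeness|apply: soundness]. Qed.
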